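(* Let $\mathbf{I} = (X,f,x_0)$ be a minimal iterator with $\omega$ the assignment of finite sets in $\mathbf{I}$, and let $\mathbf{J} = (Y,g,y_0)$ be a Peano iterator with $\omega'$ the assignment of finite sets in $\mathbf{J}$. There exists a unique operation ${\uparrow} : X \times Y \to X$ such that $$\omega(A) \uparrow \omega'(B) = \omega(A^B)$$ for all finite sets $A$ and $B$. This operation ${\uparrow}$ satisfies $$x \uparrow (y_1 \oplus y_2) = (x \uparrow y_1) \otimes (x \uparrow y_2)$$ for all $x \in X$ and all $y_1, y_2 \in Y$, and $$(x_1 \otimes x_2) \uparrow y = (x_1 \uparrow y) \otimes (x_2 \uparrow y)$$ for all $x_1, x_2 \in X$ and $y \in Y$. Moreover, ${\uparrow}$ is the unique operation $X \times Y \to X$ such that (e0) $x \uparrow y_0 = f(x_0)$ for all $x \in X$; (e1) $x \uparrow g(y) = x \otimes (x \uparrow y)$ for all $x \in X$, $y \in Y$. Here $\otimes$ is the multiplication on $X$ associated with $\mathbf{I}$ and $\oplus$ (in $y_1 \oplus y_2$) is the addition on $Y$ associated with $\mathbf{J}$.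
   Context: A set $E$ is finite if $\mathcal{P}(E)$ is the only subset $\mathcal{S}$ of the power set $\mathcal{P}(E)$ such that $\varnothing \in \mathcal{S}$ and $F \cup \{e\} \in \mathcal{S}$ whenever $F \in \mathcal{S}$, $F \neq E$ and $e \in E \setminus F$ (this is equivalent to the usual notion of finiteness). $\mathsf{Fin}$ denotes the (proper) class of all finite sets, and $A^B$ is the set of all mappings from $B$ to $A$. An iterator is a triple $\mathbf{I} = (X,f,x_0)$ with $X$ a class (a set or a proper class), $f : X \to X$ a mapping and $x_0$ an element of $X$. The assignment of finite sets in $\mathbf{I}$ is the unique mapping $\omega : \mathsf{Fin} \to X$ with $\omega(\varnothing) = x_0$ and $\omega(A \cup \{a\}) = f(\omega(A))$ for each finite set $A$ and each element $a \notin A$. A subclass $Z$ of $X$ is $f$-invariant if $f(z) \in Z$ for all $z \in Z$. $\mathbf{I}$ is minimal if the only $f$-invariant subclass of $X$ containing $x_0$ is $X$ itself, and it is a Peano iterator if it is minimal, $f$ is injective and $x_0 \notin f(X)$. For a minimal iterator $\mathbf{I} = (X,f,x_0)$ with assignment $\omega$ there are unique binary operations $\oplus$ (the addition associated with $\mathbf{I}$) and $\otimes$ (the multiplication associated with $\mathbf{I}$) on $X$ such that $\omega(A) \oplus \omega(B) = \omega(A \cup B)$ for all disjoint finite sets $A,B$ and $\omega(A) \otimes \omega(B) = \omega(A \times B)$ for all finite sets $A,B$. *)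

(* Defs.v *)
From mathcomp Require Import ssreflect ssrfun ssrbool eqtype ssrnat.
From mathcomp Require Import fintype finset.
From mathcomp Require Import boolp classical_sets functions cardinality.

Set Implicit Arguments.
Unset Strict Implicit.
Unset Printing Implicit Defensive.

Local Open Scope classical_set_scope.

(** * Finite sets

    A "set" is a subset [E : set U] of an arbitrary type [U]. *)

Definition is_finite (U : Type) (E : set U) : Prop :=
  forall S : set (set U),
    S `<=` [set F | F `<=` E] ->
    S set0 ->
    (forall (F : set U) (e : U), S F -> F <> E -> (E `\` F) e ->
       S (F `|` [set e])) ->
    S = [set F | F `<=` E].

Lemma is_finiteP (U : Type) (E : set U) : is_finite E <-> finite_set E.
Proof.
split=> [finE|[n En] S SE S0 SU].
  suff /seteqP[_ /(_ E)[]//] : [set F | F `<=` E /\ finite_set F] =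
    [set F | F `<=` E] by [].
  apply: finE => [F []//||F e [FE finF] _ [Ee _]]; first by split.
  split; first by move=> x [/FE//|->].
  by rewrite finite_setU; split=> //; exact: finite_set1.
apply/seteqP; split=> // F FE.
have [m] : finite_set F by apply: sub_finite_set FE _; exists n.
elim: m => [|m IHm] in F FE *.
  by rewrite II0 card_eq0 => /eqP ->.
move=> /eq_cardSP[x Fx Fm].
have -> : F = F `\ x `|` [set x] by rewrite setUC setD1K.
apply: SU.
- by apply: IHm Fm => y [/FE].
- by move=> FxE; have := FE _ Fx; rewrite -FxE => -[_]; exact.
- by split; [exact: FE|case=> _; exact].
Qed.

Record finSet (U : Type) := FinSet {
  elts :> set U;
  finite_elts : is_finite elts
}.
Arguments finite_elts {U} _.

(** The class of all finite sets; it lives in a universe above that of the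
    types [U], just as the class of all finite sets is proper. *)
Record Fin := InFin { ambient : Type; underlying : finSet ambient }.
Coercion InFin : finSet >-> Fin.

Definition fin_empty (U : Type) : finSet U :=
  FinSet ((is_finiteP set0).2 (finite_set0 U)).

Lemma is_finiteU (U : Type) (A B : finSet U) : is_finite (A `|` B).
Proof.
by apply/is_finiteP; rewrite finite_setU; split; apply/is_finiteP/finite_elts.
Qed.

Definition fin_union (U : Type) (A B : finSet U) : finSet U :=
  FinSet (@is_finiteU U A B).

Definition fin_single (U : Type) (a : U) : finSet U :=
  FinSet ((is_finiteP [set a]).2 (finite_set1 a)).

Lemma is_finiteX (U V : Type) (A : finSet U) (B : finSet V) :
  is_finite (A `*` B).
Proof. by apply/is_finiteP/finite_setX; apply/is_finiteP/finite_elts. Qed.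

Definition fin_prod (U V : Type) (A : finSet U) (B : finSet V) :
  finSet (U * V) := FinSet (@is_finiteX U V A B).

Lemma finite_index (U : Type) (A : finSet U) :
  exists (n : nat) (i : A -> 'I_n), injective i.
Proof.
have [n] := (is_finiteP _).1 (finite_elts A).
rewrite card_eq_le => /andP[/pcard_leP[f] _].
have fn (x : A) : f (val x) < n.
  by have /(_ (val x) (set_mem (valP x))) := 'funS_f.
exists n, (fun x => Ordinal (fn x)) => x y [].
by move=> /('inj_f (valP x) (valP y)); exact: val_inj.
Qed.

Lemma is_finite_fun (U V : Type) (A : finSet U) (B : finSet V) :
  is_finite [set: elts B -> elts A].
Proof.
have [n [i inji]] := finite_index A; have [m [j injj]] := finite_index B.
apply/is_finiteP.
pose graph (h : elts B -> elts A) : {set 'I_m * 'I_n} :=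
  [set p | `[< exists b, p = (j b, i (h b)) >]]%SET.
have injg : injective graph.
  move=> h k hk; apply/funext => b.
  have : (j b, i (h b)) \in graph h by rewrite inE; apply/asboolP; exists b.
  by rewrite hk inE => /asboolP[c [/injj <- /inji]].
rewrite -(preimage_setT graph); apply/finite_set_leP.
have [l finl] : finite_set [set: {set 'I_m * 'I_n}] by exact: finite_finset.
exists l; rewrite -(card_le_eqr finl); apply: card_ge_preimage.
by move=> h k _ _; exact: injg.
Qed.

(** [A ^ B], the set of all mappings from [B] to [A], where [elts A] and
    [elts B] are regarded as (sub)types. *)
Definition fin_exp (U V : Type) (A : finSet U) (B : finSet V) :
  finSet (elts B -> elts A) := FinSet (@is_finite_fun U V A B).

(** * Iterators

    Subclasses of the carrier are plain predicates rather than [set]s: [set] is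
    not universe polymorphic, and using it here would force the carrier into
    the universe of the types [U], thereby excluding proper classes. *)

Record iterator := Iterator {
  carrier :> Type;
  next : carrier -> carrier;
  start : carrier
}.

Definition invariant (I : iterator) (Z : I -> Prop) : Prop :=
  forall z, Z z -> Z (next z).

Definition minimal (I : iterator) : Prop :=
  forall Z : I -> Prop, invariant Z -> Z (start I) -> forall x, Z x.

Definition Peano (I : iterator) : Prop :=
  [/\ minimal I, injective (@next I) & ~ exists x : I, next x = start I].

Definition assignment (I : iterator) (w : Fin -> I) : Prop :=
  (forall U : Type, w (fin_empty U) = start I) /\
  (forall (U : Type) (A : finSet U) (a : U), ~ elts A a ->
     w (fin_union A (fin_single a)) = next (w A)).

Definition addition (I : iterator) (w : Fin -> I) (add : I -> I -> I) : Prop :=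
  forall (U : Type) (A B : finSet U), A `&` B = set0 ->
    add (w A) (w B) = w (fin_union A B).

Definition multiplication (I : iterator) (w : Fin -> I) (mul : I -> I -> I) :
    Prop :=
  forall (U V : Type) (A : finSet U) (B : finSet V),
    mul (w A) (w B) = w (fin_prod A B).

(** * Exponentiation *)

Definition exponentiation (I J : iterator) (w : Fin -> I) (w' : Fin -> J)
    (pow : I -> J -> I) : Prop :=
  forall (U V : Type) (A : finSet U) (B : finSet V),
    pow (w A) (w' B) = w (fin_exp A B).

Definition exp_recursion (I J : iterator) (mul : I -> I -> I)
    (pow : I -> J -> I) : Prop :=
  (forall x : I, pow x (start J) = next (start I)) /\
  (forall (x : I) (y : J), pow x (next y) = mul x (pow x y)).

(* Main.v *)
From mathcomp Require Import all_boot.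
From mathcomp Require Import boolp classical_sets functions cardinality.
Require Import Defs.


(** The assignment of finite sets only sees cardinality: if [A] has [n]
    elements, then [w A] is the [n]-th iterate of the start, written
    [numeral I n] ([assignment_fintype]). In a minimal iterator every element
    is a numeral ([minimal_numeral]), so each operation defined through finite
    sets is determined by its values on numerals, where it is an operation on
    cardinals: addition becomes [m + n], multiplication [m * n], and
    [exponentiation w w' pow] says exactly that
    [pow (numeral I m) (numeral J n) = numeral I (m ^ n)]
    ([exponentiationP]). The recursion (e0), (e1) forces the same values
    ([exp_recursion_numeral]). Hence both uniqueness claims reduce to this
    formula, and the two power laws reduce to [expnD] and [expnMn].

    What remains is existence. The formula cannot be used as a definition at
    once, since distinct [m] may name the same [x] when [I] is not a Peano
    iterator. The recursion (e0), (e1) does not mention a representative of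
    [x], and it has a solution because [J] is a Peano iterator, so that its
    elements correspond bijectively to natural numbers
    ([exp_recursion_exists]). *)

Set Implicit Arguments.
Unset Strict Implicit.
Unset Printing Implicit Defensive.

Local Open Scope classical_set_scope.
Local Open Scope card_scope.

Lemma finSet_eq (U : Type) (A B : finSet U) : elts A = elts B -> A = B.
Proof.
case: A B => [A finA] [B finB] /= eqAB; case: B / eqAB finB => finB.
by rewrite (Prop_irrelevance finA finB).
Qed.

Definition fin_full (F : finType) : finSet F :=
  FinSet ((is_finiteP [set: F]).2 (@finite_finset F _)).

Lemma bij_card_setT (T U : Type) (f : T -> U) :
  bijective f -> [set: T] #= [set: U].
Proof.
move=> [g fK gK]; rewrite card_eq_sym.
suff <- : f @` [set: T] = [set: U].
  by apply: inj_card_eq => x y _ _; exact: (can_inj fK).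
by apply/seteqP; split=> // y _; exists (g y).
Qed.

(** [card_bijP] speaks of the subtypes of both sets; here the full set is
    replaced by its ambient type, on which functions are easier to build. *)
Lemma card_eq_bij (U V : Type) (A : set U) :
  A #= [set: V] -> exists f : A -> V, bijective f.
Proof.
move=> /card_bijP[f bijf]; exists (val \o f); apply: bij_comp bijf.
by exists (fun x => SigSub (mem_set (I : [set: V] x))) => [x|x //]; exact/val_inj.
Qed.

(** The reason why [w (A ^ B)] depends only on the cardinals of [A] and [B]:
    bijections of base and exponent transport mappings by conjugation. *)
Lemma card_eq_fun (U V : Type) (A : set U) (B : set V) (F G : finType) :
  A #= [set: F] -> B #= [set: G] ->
  [set: B -> A] #= [set: {ffun G -> F}].
Proof.
move=> /card_eq_bij[f [f' fK f'K]] /card_eq_bij[g [g' gK g'K]].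
apply: (bij_card_setT (f := fun h : B -> A => [ffun y => f (h (g' y))])).
exists (fun k : {ffun G -> F} => fun x => f' (k (g x))) => [h|k].
  by apply/funext => x; rewrite ffunE fK gK.
by apply/ffunP => y; rewrite ffunE f'K g'K.
Qed.

Lemma card_finSet (U : Type) (A : finSet U) : exists n, A #= [set: 'I_n].
Proof.
have [n An] := (is_finiteP A).1 (finite_elts A).
by exists n; rewrite (card_eql An) card_II.
Qed.

Lemma card_fintype (F : finType) : [set: F] #= `I_#|F|.
Proof.
by rewrite (card_eqr card_II); apply: bij_card_setT (@enum_rank_bij F).
Qed.

Definition numeral (I : iterator) (n : nat) : I := iter n (@next I) (start I).
Arguments numeral : clear implicits.

Lemma minimal_numeral (I : iterator) (minI : minimal I) (x : I) :
  exists n, x = numeral I n.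
Proof.
apply: (minI (fun x => exists n, x = numeral I n)) x; last by exists 0.
by move=> _ [n ->]; exists n.+1.
Qed.

(** Injectivity of [next] cancels successors on both sides; the remaining case
    would make the start a successor. *)
Lemma Peano_numeral_inj (I : iterator) : Peano I -> injective (numeral I).
Proof.
move=> [_ injS S0] m n; elim: m n => [|m IHm] [|n] //= eqmn.
- by case: S0; exists (numeral I n).
- by case: S0; exists (numeral I m).
- by rewrite (IHm n) //; apply: injS.
Qed.

(** Induction on the cardinal: removing a point [x] from [A] exhibits [A] as
    [(A `\ x) `|` [set x]], which is the shape that the second clause of
    [assignment] evaluates. *)
Lemma assignmentE (I : iterator) (w : Fin -> I) (U : Type) (A : finSet U) n :
  assignment w -> A #= `I_n -> w A = numeral I n.
Proof.
move=> [w0 wS]; elim: n => [|n IHn] in A *.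
  rewrite II0 card_eq0 => /eqP A0.
  by have -> : A = fin_empty U by [exact: finSet_eq]; exact: w0.
move=> /eq_cardSP[x Ax Axn].
have finAx : is_finite (A `\ x) by apply/is_finiteP; exists n.
have -> : A = fin_union (FinSet finAx) (fin_single x).
  by apply: finSet_eq; rewrite /= setUC setD1K.
by rewrite wS /=; [rewrite IHn|case=> _; apply].
Qed.

(** Measuring cardinals by finite types lets [card_sum], [card_prod] and
    [card_ffun] do the arithmetic. *)
Lemma assignment_fintype (I : iterator) (w : Fin -> I) (U : Type)
    (A : finSet U) (F : finType) :
  assignment w -> A #= [set: F] -> w A = numeral I #|F|.
Proof.
by move=> wP AF; apply: assignmentE => //; rewrite (card_eql AF) card_fintype.
Qed.

Lemma assignment_ord (I : iterator) (w : Fin -> I) n :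
  assignment w -> w (fin_full 'I_n) = numeral I n.
Proof. by move=> wP; rewrite (assignment_fintype (F := 'I_n)) ?card_ord. Qed.

(** Disjoint representatives of [m] and [n] are the two halves of the sum type
    ['I_m + 'I_n]. *)
Lemma addition_numeral (I : iterator) (w : Fin -> I) (add : I -> I -> I) m n :
  assignment w -> addition w add ->
  add (numeral I m) (numeral I n) = numeral I (m + n).
Proof.
move=> wP addP; pose T := ('I_m + 'I_n)%type.
pose A : finSet T :=
  FinSet ((is_finiteP _).2 (@finite_finset T (inl @` [set: 'I_m]))).
pose B : finSet T :=
  FinSet ((is_finiteP _).2 (@finite_finset T (inr @` [set: 'I_n]))).
have -> : numeral I m = w A.
  rewrite (assignment_fintype (F := 'I_m)) ?card_ord//.
  by apply: inj_card_eq => x y _ _ [].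
have -> : numeral I n = w B.
  rewrite (assignment_fintype (F := 'I_n)) ?card_ord//.
  by apply: inj_card_eq => x y _ _ [].
rewrite addP; last by apply/seteqP; split=> // _ [/= [x _ <-]] [].
rewrite (assignment_fintype (F := T)) ?card_sum ?card_ord//=.
suff -> : inl @` [set: 'I_m] `|` inr @` [set: 'I_n] = [set: T] by [].
by apply/seteqP; split=> // -[x|x] _; [left|right]; exists x.
Qed.

Lemma multiplication_numeral (I : iterator) (w : Fin -> I)
    (mul : I -> I -> I) m n :
  assignment w -> multiplication w mul ->
  mul (numeral I m) (numeral I n) = numeral I (m * n).
Proof.
move=> wP mulP; rewrite -(assignment_ord m wP) -(assignment_ord n wP) mulP.
by rewrite (assignment_fintype (F := ('I_m * 'I_n)%type)) ?card_prod ?card_ord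
           //= setXTT.
Qed.

(** The characterization by finite sets and the one by numerals agree for an
    arbitrary [I]: evaluating at the full sets of ['I_m] and ['I_n] gives the
    values on numerals, and conversely every finite set is equinumerous to one
    of those. *)
Lemma exponentiationP (I J : iterator) (w : Fin -> I) (w' : Fin -> J)
    (pow : I -> J -> I) :
  assignment w -> assignment w' ->
  exponentiation w w' pow <->
  forall m n, pow (numeral I m) (numeral J n) = numeral I (m ^ n).
Proof.
move=> wP w'P; split=> [powP m n|pow_num U V A B].
  rewrite -(assignment_ord m wP) -(assignment_ord n w'P) powP.
  rewrite (assignment_fintype (F := {ffun 'I_n -> 'I_m})) //.
    by rewrite card_ffun !card_ord.
  exact: card_eq_fun.
have [m Am] := card_finSet A; have [n Bn] := card_finSet B.
rewrite (assignment_fintype wP Am) (assignment_fintype w'P Bn) !card_ord pow_num.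
rewrite (assignment_fintype wP (F := {ffun 'I_n -> 'I_m})).
  by rewrite card_ffun !card_ord.
exact: card_eq_fun.
Qed.

Lemma exp_recursion_numeral (I J : iterator) (mul : I -> I -> I)
    (pow : I -> J -> I) :
  (forall m n, mul (numeral I m) (numeral I n) = numeral I (m * n)) ->
  exp_recursion mul pow ->
  forall m n, pow (numeral I m) (numeral J n) = numeral I (m ^ n).
Proof.
by move=> mul_num [pow0 powS] m; elim=> [|n IHn]; rewrite ?pow0 //= powS IHn
          mul_num expnS.
Qed.

(** The solution multiplies [log y] times by [x], starting from the unit
    [next (start I)], where [log y] is the natural number that [y] denotes.
    That number is unambiguous, and increases by one from [y] to [next y],
    because numerals of a Peano iterator are injective. *)
Lemma exp_recursion_exists (I J : iterator) (mul : I -> I -> I) :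
  Peano J -> exists pow : I -> J -> I, exp_recursion mul pow.
Proof.
move=> peanoJ; have [minJ _ _] := peanoJ.
have numJ_inj := Peano_numeral_inj peanoJ.
have [log logK] : exists log : J -> nat, cancel log (numeral J).
  exists (fun y => projT1 (cid (minimal_numeral minJ y))) => y.
  by case: cid => n /= ->.
have log_num n : log (numeral J n) = n by apply: numJ_inj; rewrite logK.
exists (fun x y => iter (log y) (mul x) (next (start I))); split=> [x|x y].
  by rewrite (log_num 0).
by rewrite -[in LHS](logK y) (log_num (log y).+1).
Qed.

Theorem theorem10p3
  (I : iterator) (minI : minimal I)
  (w : Fin -> I) (w_assign : assignment w)
  (mul : I -> I -> I) (mul_I : multiplication w mul)
  (J : iterator) (peanoJ : Peano J)
  (w' : Fin -> J) (w'_assign : assignment w')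
  (add : J -> J -> J) (add_J : addition w' add) :
  exists pow : I -> J -> I,
    unique (exponentiation w w') pow /\
    (forall (x : I) (y1 y2 : J),
        pow x (add y1 y2) = mul (pow x y1) (pow x y2)) /\
    (forall (x1 x2 : I) (y : J),
        pow (mul x1 x2) y = mul (pow x1 y) (pow x2 y)) /\
    unique (exp_recursion mul) pow.
Proof.
have [minJ _ _] := peanoJ.
have numI x := minimal_numeral minI x; have numJ y := minimal_numeral minJ y.
have mul_num m n := multiplication_numeral m n w_assign mul_I.
have add_num m n := addition_numeral m n w'_assign add_J.
have [pow powR] := exp_recursion_exists mul peanoJ.
have pow_num := exp_recursion_numeral mul_num powR.
have pow_unique pow' :
    (forall m n, pow' (numeral I m) (numeral J n) = numeral I (m ^ n)) ->
  pow = pow'.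
  move=> pow'_num; apply/funext => x; apply/funext => y.
  by have [m ->] := numI x; have [n ->] := numJ y; rewrite pow_num pow'_num.
exists pow; split; [|split; [|split]].
- split; first exact/exponentiationP.
  by move=> pow' /exponentiationP pow'_num; apply/pow_unique/pow'_num.
- move=> x y1 y2; have [m ->] := numI x.
  have [n1 ->] := numJ y1; have [n2 ->] := numJ y2.
  by rewrite add_num !pow_num mul_num expnD.
- move=> x1 x2 y; have [m1 ->] := numI x1; have [m2 ->] := numI x2.
  by have [n ->] := numJ y; rewrite mul_num !pow_num mul_num expnMn.
- split=> // pow' pow'R; apply: pow_unique.
  exact: exp_recursion_numeral mul_num pow'R.
Qed.
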